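(* Let $(M^{2d},\omega,\Theta,g)$ be an almost Kähler manifold with Levi-Civita connection $\nabla^{lc}$ of $g$. The following statements are equivalent: (1) $M^{2d}$ is a statistical almost-Kähler manifold; (2) $R^{\nabla^{lc}}\circ\Theta=\Theta\circ R^{\nabla^{lc}}$, i.e. $R^{\nabla^{lc}}(X,Y)\Theta Z=\Theta R^{\nabla^{lc}}(X,Y)Z$ for all vector fields $X,Y,Z$; (3) $M^{2d}$ is a Kähler manifold.
   Context: An almost Kähler manifold $(M^{2d},\omega,\Theta,g)$ is a symplectic manifold $(M^{2d},\omega)$ with an almost Hermitian structure $(g,\Theta)$: $\Theta$ is an almost complex structure, $g$ a $\Theta$-invariant Riemannian metric, and $\omega=g(\Theta\cdot,\cdot)$. The dual connection $\nabla^*$ of $\nabla$ with respect to $g$ is defined by $X\,g(Y,Z)=g(\nabla_XY,Z)+g(Y,\nabla^*_XZ)$. A statistical almost-Kähler manifold is an almost Kähler manifold admitting a pair $(\nabla,\nabla^* )$ of torsion-free linear connections, dual with respect to $g$, with $\nabla\omega=0$. $R^{\nabla}$ denotes the curvature tensor of $\nabla$. *)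

(* Defs.v *)
From HB Require Import structures.
From mathcomp Require Import all_boot all_order all_algebra.
From mathcomp Require Import all_classical all_reals all_analysis.
Import Order.TTheory GRing.Theory Num.Theory.
Import numFieldNormedType.Exports.

Set Implicit Arguments.
Unset Strict Implicit.
Unset Printing Implicit Defensive.

Local Open Scope classical_set_scope.
Local Open Scope ring_scope.

Section SmoothOnOpenSets.
Context {R : realType} {n : nat}.
Implicit Types (U : set 'rV[R]_n) (f g : 'rV[R]_n -> R).

(* Meant for open U only: f is a total function, but its values outside U are
   irrelevant. *)
Fixpoint Ck (k : nat) U f : Prop :=
  (forall x, U x -> {for x, continuous f}) /\
  if k is k'.+1 then
    forall i : 'I_n, (forall x, U x -> derivable f x (delta_mx 0 i)) /\
                     Ck k' U (fun x => 'D_(delta_mx 0 i) f x)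
  else True.

Definition smooth_on U f : Prop := forall k, Ck k U f.

Lemma Ck_ext k U f g : open U -> (forall x, U x -> f x = g x) ->
  Ck k U f -> Ck k U g.
Proof.
move=> oU; elim: k f g => [|k IH] f g fg [cf Df].
all: have nfg x (Ux : U x) : {near x, f =1 g}
  by apply: filterS (open_nbhs_nbhs (conj oU Ux)) => y; exact: fg.
all: split=> [x Ux|//i];
  first by change (g @ x --> g x); rewrite -(fg x Ux);
    exact: cvg_trans (near_eq_cvg (nfg x Ux)) (cf x Ux).
have [df DfC] := Df i; split=> [x Ux|].
  exact: near_eq_derivable (nfg x Ux) (df x Ux).
by apply: IH DfC => x Ux; exact/near_eq_derive/nfg.
Qed.

Lemma CkW k U f : Ck k.+1 U f -> Ck k U f.
Proof.
elim: k f => [|k IH] f [cf Df]; split=> // i.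
by have [df DfC] := Df i; split=> //; exact: IH.
Qed.

Lemma Ck_cst k U (c : R) : open U -> Ck k U (cst c).
Proof.
move=> oU; elim: k c => [|k IH] c; split=> //; try by move=> x _; exact: cst_continuous.
move=> i; split=> [x _|]; first exact: derivable_cst.
by apply: Ck_ext (IH 0) => // x _; rewrite derive_cst.
Qed.

Lemma CkD k U f g : open U -> Ck k U f -> Ck k U g -> Ck k U (f + g).
Proof.
move=> oU; elim: k f g => [|k IH] f g [cf Df] [cg Dg]; split=> //;
  try by move=> x Ux; apply: continuousD; [exact: cf|exact: cg].
move=> i; have [df DfC] := Df i; have [dg DgC] := Dg i; split=> [x Ux|].
  by apply: derivableD; [exact: df|exact: dg].
by apply: Ck_ext (IH _ _ DfC DgC) => // x Ux; rewrite deriveD//; [exact: df|exact: dg].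
Qed.

Lemma CkM k U f g : open U -> Ck k U f -> Ck k U g -> Ck k U (f * g).
Proof.
move=> oU; elim: k f g => [|k IH] f g Cf Cg;
  have [cf Df] := Cf; have [cg Dg] := Cg; split=> //;
  try by move=> x Ux; apply: continuousM; [exact: cf|exact: cg].
move=> i; have [df DfC] := Df i; have [dg DgC] := Dg i; split=> [x Ux|].
  by apply: derivableM; [exact: df|exact: dg].
apply: Ck_ext (CkD oU (IH _ _ (CkW Cf) DgC) (IH _ _ (CkW Cg) DfC)) => // x Ux.
by rewrite deriveM//; [exact: df|exact: dg].
Qed.

End SmoothOnOpenSets.

(* coord is only meaningful on dom, and param only on coord @` dom. *)
Record chart (R : realType) (n : nat) (M : topologicalType) := Chart {
  dom : set M ;
  coord : M -> 'rV[R]_n ;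
  param : 'rV[R]_n -> M ;
  dom_open : open dom ;
  codom_open : open (coord @` dom) ;
  coord_continuous : forall p, dom p -> {for p, continuous coord} ;
  param_continuous : forall x, (coord @` dom) x -> {for x, continuous param} ;
  coordK : forall p, dom p -> param (coord p) = p }.

(* The atlas need not be maximal. *)
Record manifold (R : realType) (n : nat) := Manifold {
  carrier :> topologicalType ;
  atlas : set (chart R n carrier) ;
  manifold_hausdorff : hausdorff_space carrier ;
  manifold_second_countable : @second_countable carrier ;
  atlas_cover : forall p, exists2 phi, atlas phi & dom phi p ;
  atlas_smooth : forall phi psi, atlas phi -> atlas psi -> forall i : 'I_n,
    smooth_on (coord phi @` (dom phi `&` dom psi))
              (fun x => coord psi (param phi x) 0 i) }.

Section SmoothFunctions.
Context {R : realType} {n : nat} (M : manifold R n).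

Definition smooth (f : M -> R) : Prop :=
  forall phi, atlas phi -> smooth_on (coord phi @` dom phi) (f \o param phi).

Record smooth_function := SmoothFunction {
  smooth_fun :> M -> R ;
  _ : `[< smooth smooth_fun >] }.

HB.instance Definition _ := [isSub for smooth_fun].
HB.instance Definition _ := [Choice of smooth_function by <:].

Fact smooth_cst c : smooth (cst c : M -> R).
Proof. by move=> phi aphi k; exact: (Ck_cst k c (@codom_open _ _ _ phi)). Qed.

Fact smoothM (f g : M -> R) : smooth f -> smooth g -> smooth (f * g).
Proof.
move=> sf sg phi aphi k.
exact: (CkM (@codom_open _ _ _ phi) (sf phi aphi k) (sg phi aphi k)).
Qed.

Fact smoothD (f g : M -> R) : smooth f -> smooth g -> smooth (f + g).
Proof.
move=> sf sg phi aphi k.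
exact: (CkD (@codom_open _ _ _ phi) (sf phi aphi k) (sg phi aphi k)).
Qed.

Fact smooth_subring_closed :
  subring_closed (fun f : M -> R => `[< smooth f >]).
Proof.
split; first exact/asboolP/(smooth_cst 1).
- move=> f g /asboolP sf /asboolP sg; apply/asboolP.
  by rewrite -mulN1r; apply/smoothD/smoothM/sg/(smooth_cst (-1)).
- by move=> f g /asboolP sf /asboolP sg; apply/asboolP; exact: smoothM.
Qed.

HB.instance Definition _ := GRing.SubChoice_isSubComPzRing.Build _ _
  smooth_function smooth_subring_closed.

Fact smooth_subsemimod_closed :
  GRing.subsemimod_closed (fun f : M -> R => `[< smooth f >]).
Proof.
split; [split|]; first exact/asboolP/(smooth_cst 0).
- by move=> f g /asboolP sf /asboolP sg; apply/asboolP; exact: smoothD.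
- by move=> a f /asboolP sf; apply/asboolP; exact: smoothM (smooth_cst a) sf.
Qed.

HB.instance Definition _ := GRing.SubZmodule_isSubLmodule.Build _ _ _
  smooth_function smooth_subsemimod_closed.

End SmoothFunctions.

Section VectorFields.
Context {R : realType} {n : nat} (M : manifold R n).
Local Notation C := (smooth_function M).

Definition derivation (X : C -> C) : Prop :=
  (forall (a : R) (f h : C), X (a *: f + h) = a *: X f + X h) /\
  (forall f h : C, X (f * h) = X f * h + f * X h).

(* Smooth vector fields are identified with the R-linear derivations of the
   algebra of global smooth functions. *)
Record vector_field := VectorField {
  vf_fun :> C -> C ;
  _ : `[< derivation vf_fun >] }.

HB.instance Definition _ := [isSub for vf_fun].
HB.instance Definition _ := [Choice of vector_field by <:].

Lemma vf_derivation (X : vector_field) : derivation X.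
Proof. by case: X => X hX; exact/asboolP. Qed.

Lemma vfD (X : vector_field) (f h : C) : X (f + h) = X f + X h.
Proof. by have := (vf_derivation X).1 1 f h; rewrite !scale1r. Qed.

Lemma vfM (X : vector_field) (f h : C) : X (f * h) = X f * h + f * X h.
Proof. exact: (vf_derivation X).2. Qed.

Fact derivation_zmod_closed :
  zmod_closed (fun X : C -> C => `[< derivation X >]).
Proof.
split.
- apply/asboolP; split=> [a f h|f h].
    by rewrite [LHS]/(0 : C) scaler0 addr0.
  by rewrite [LHS]/(0 : C) mul0r mulr0 addr0.
- move=> X Y /asboolP[linX mulX] /asboolP[linY mulY].
  have BE f : (X - Y) f = X f - Y f by [].
  apply/asboolP; split=> [a f h|f h].
    by rewrite !BE linX linY opprD addrACA -scalerBr.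
  by rewrite !BE mulX mulY opprD addrACA -mulrBl -mulrBr.
Qed.

HB.instance Definition _ := GRing.SubChoice_isSubZmodule.Build _ _
  vector_field derivation_zmod_closed.

Fact scale_vf_derivation (u : C) (X : vector_field) :
  `[< derivation (fun f => u * X f) >].
Proof.
have ZA (a : R) (f h : C) : f * (a *: h) = a *: (f * h).
  by apply: val_inj; apply: funext => p; exact: mulrCA.
have [linX mulX] := vf_derivation X.
apply/asboolP; split=> [a f h|f h].
  by rewrite linX mulrDr ZA.
by rewrite mulX mulrDr mulrA (mulrCA u).
Qed.

Definition scale_vf (u : C) (X : vector_field) : vector_field :=
  VectorField (scale_vf_derivation u X).

Lemma vf_ext (X Y : vector_field) : (forall f, X f = Y f) -> X = Y.
Proof. by move=> XY; apply: val_inj; apply: funext. Qed.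

Fact scale_vfA u v X : scale_vf u (scale_vf v X) = scale_vf (u * v) X.
Proof. by apply: vf_ext => f; exact: mulrA. Qed.

Fact scale_vf1 : left_id 1 scale_vf.
Proof. by move=> X; apply: vf_ext => f; exact: mul1r. Qed.

Fact scale_vfDr : right_distributive scale_vf +%R.
Proof. by move=> u X Y; apply: vf_ext => f; exact: mulrDr. Qed.

Fact scale_vfDl X : {morph scale_vf^~ X : u v / u + v}.
Proof. by move=> u v; apply: vf_ext => f; exact: mulrDl. Qed.

HB.instance Definition _ := GRing.Zmodule_isLmodule.Build C vector_field
  scale_vfA scale_vf1 scale_vfDr scale_vfDl.

Fact lie_bracket_derivation (X Y : vector_field) :
  `[< derivation (fun f => X (Y f) - Y (X f)) >].
Proof.
have [linX _] := vf_derivation X; have [linY _] := vf_derivation Y.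
apply/asboolP; split=> [a f h|f h].
  by rewrite linY linX linX linY scalerBr opprD addrACA.
have cross (a b c e x y z t : C) :
    a * b + c + (x + e * y) - (z * b + x + (c + e * t)) =
    (a - z) * b + e * (y - t).
  rewrite mulrBl mulrBr !opprD !addrA [LHS](ACl (1*5*(2*7)*(3*6)*4*8))/=.
  by rewrite !subrr !addr0.
rewrite !(vfM, vfD); exact: cross.
Qed.

Definition lie_bracket (X Y : vector_field) : vector_field :=
  VectorField (lie_bracket_derivation X Y).

End VectorFields.

Section Geometry.
Context {R : realType} {n : nat} {M : manifold R n}.
Local Notation C := (smooth_function M).
Local Notation VF := (vector_field M).
Local Notation "[[ X , Y ]]" := (lie_bracket X Y).
Implicit Types (X Y Z : VF) (u : C) (p : M).

(* X_p = 0 as a tangent vector at p. *)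
Definition vanishes_at X p : Prop := forall f : C, X f p = 0.

(* Covariant 2-tensor fields are C^oo(M)-bilinear maps on vector fields, and
   endomorphism fields of the tangent bundle are C^oo(M)-linear maps. *)
Definition tensor2 (b : VF -> VF -> C) : Prop :=
  (forall u X Y Z, b (u *: X + Y) Z = u * b X Z + b Y Z) /\
  (forall u X Y Z, b Z (u *: X + Y) = u * b Z X + b Z Y).

Definition endomorphism (A : VF -> VF) : Prop :=
  forall u X Y, A (u *: X + Y) = u *: A X + A Y.

Definition riemannian_metric (g : VF -> VF -> C) : Prop :=
  [/\ tensor2 g,
      forall X Y, g X Y = g Y X
    & forall X p, ~ vanishes_at X p -> 0 < g X X p].

Definition ext_derivative (w : VF -> VF -> C) X Y Z : C :=
  X (w Y Z) - Y (w X Z) + Z (w X Y)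
  - w [[X, Y]] Z + w [[X, Z]] Y - w [[Y, Z]] X.

Definition symplectic_form (w : VF -> VF -> C) : Prop :=
  [/\ tensor2 w,
      forall X, w X X = 0,
      forall X Y Z, ext_derivative w X Y Z = 0
    & forall X p, (forall Y, w X Y p = 0) -> vanishes_at X p].

Definition almost_complex_structure (Theta : VF -> VF) : Prop :=
  endomorphism Theta /\ forall X, Theta (Theta X) = - X.

Definition almost_kahler (w : VF -> VF -> C) (Theta : VF -> VF)
    (g : VF -> VF -> C) : Prop :=
  [/\ symplectic_form w, almost_complex_structure Theta, riemannian_metric g,
      forall X Y, g (Theta X) (Theta Y) = g X Y
    & forall X Y, w X Y = g (Theta X) Y].

(* nabla X Y is the covariant derivative of Y along X. *)
Definition linear_connection (nabla : VF -> VF -> VF) : Prop :=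
  [/\ forall u X Y Z, nabla (u *: X + Y) Z = u *: nabla X Z + nabla Y Z,
      forall X Y Z, nabla X (Y + Z) = nabla X Y + nabla X Z
    & forall u X Y, nabla X (u *: Y) = X u *: Y + u *: nabla X Y].

Definition torsion_free (nabla : VF -> VF -> VF) : Prop :=
  forall X Y, nabla X Y - nabla Y X = [[X, Y]].

Definition curvature (nabla : VF -> VF -> VF) X Y Z : VF :=
  nabla X (nabla Y Z) - nabla Y (nabla X Z) - nabla [[X, Y]] Z.

Definition cov_derivative2 (nabla : VF -> VF -> VF) (b : VF -> VF -> C)
    X Y Z : C :=
  X (b Y Z) - b (nabla X Y) Z - b Y (nabla X Z).

Definition parallel2 (nabla : VF -> VF -> VF) (b : VF -> VF -> C) : Prop :=
  forall X Y Z, cov_derivative2 nabla b X Y Z = 0.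

Definition levi_civita (g : VF -> VF -> C) (nabla : VF -> VF -> VF) : Prop :=
  [/\ linear_connection nabla, torsion_free nabla & parallel2 nabla g].

Definition dual_connections (g : VF -> VF -> C)
    (nabla nabla' : VF -> VF -> VF) : Prop :=
  forall X Y Z, X (g Y Z) = g (nabla X Y) Z + g Y (nabla' X Z).

Definition statistical_almost_kahler (w : VF -> VF -> C) (Theta : VF -> VF)
    (g : VF -> VF -> C) : Prop :=
  almost_kahler w Theta g /\
  exists nabla nabla' : VF -> VF -> VF,
    [/\ linear_connection nabla /\ linear_connection nabla',
        torsion_free nabla /\ torsion_free nabla',
        dual_connections g nabla nabla'
      & parallel2 nabla w].

(* Integrability of an almost complex structure is the vanishing of its
   Nijenhuis tensor; no Newlander-Nirenberg theorem is built in. *)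
Definition nijenhuis (Theta : VF -> VF) X Y : VF :=
  [[Theta X, Theta Y]] - Theta [[Theta X, Y]] - Theta [[X, Theta Y]] - [[X, Y]].

Definition integrable (Theta : VF -> VF) : Prop :=
  forall X Y, nijenhuis Theta X Y = 0.

Definition kahler (w : VF -> VF -> C) (Theta : VF -> VF)
    (g : VF -> VF -> C) : Prop :=
  almost_kahler w Theta g /\ integrable Theta.

End Geometry.

(* Main.v *)
Require Import Defs.
From mathcomp Require Import all_boot all_order all_algebra.
From mathcomp Require Import all_classical all_reals all_analysis.
From mathcomp Require Import ring lra.
Import Order.TTheory GRing.Theory Num.Theory.

(** Let [A X Y = (nabla_X Theta) Y] for the Levi-Civita connection [nabla].
    Everything reduces to the symmetry of [A], through the following loop.

    - [A] is skew with respect to [g] in [Y] and the third slot of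
      [g (A X Y) Z]. A trilinear form symmetric in its first two arguments and
      skew in its last two is zero, so [A] is symmetric iff [A = 0]
      ([symmetric_parallel]).
    - The Nijenhuis tensor of [Theta] is an expression in [A]
      ([nijenhuisE]). Since [omega] is closed, [A (Theta X) = - Theta (A X)]
      ([quasi_kahler]), and the Nijenhuis tensor becomes
      [- 2 Theta (A X Y - A Y X)]. Thus Kaehler iff [A] symmetric iff [A = 0].
    - If [A = 0], then [omega] is parallel and [nabla] is its own dual, which
      gives a statistical structure, and the curvature commutes with [Theta].
    - For a statistical structure [(D, D')], duality and [D omega = 0] give
      [D' = Theta D Theta^-1]; as [D] and [D'] are both torsion-free, [D Theta]
      is symmetric, and a torsion-free connection with this property forces
      the Nijenhuis tensor to vanish ([statistical_integrable]).

    The remaining implication, from the curvature condition to [A = 0], is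
    Goldberg's integrability theorem. It is usually proved by tracing a
    Weitzenboeck-type identity; the argument here needs no trace. By the Ricci
    identity the curvature condition says that the second covariant derivative
    [B X Y = (nabla_X A)_Y] is symmetric in [X] and [Y]. Differentiating
    [A (Theta X) = - Theta (A X)] gives

      [B W (Theta X) = - Theta (B W X) - A W A X - A (A W X)],

    so that, [B] being symmetric, [B (Theta W) (Theta X)] can be computed by
    pulling out the two occurrences of [Theta] in either order. The two results
    agree only if [A T = 0] for [T = A W X - A X W]
    ([cov_bil_symmetric_cov_end]). The cyclic identity
    [g (A X Y) Z + g (A Y Z) X + g (A Z X) Y = 0], which is the closedness of
    [omega], applied to [T, W, X] then reads [g T T = 0], and [T = 0]
    ([curvature_symmetric]). *)

Set Implicit Arguments.
Unset Strict Implicit.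
Unset Printing Implicit Defensive.

Local Open Scope ring_scope.

(** * Pointwise reduction of identities *)

Lemma morphD_morph0 (U V : zmodType) (f : U -> V) :
  {morph f : x y / x + y} -> f 0 = 0.
Proof. by move=> fD; apply: (@addrI _ (f 0)); rewrite -fD !addr0. Qed.

Lemma morphD_morphN (U V : zmodType) (f : U -> V) :
  {morph f : x y / x + y} -> {morph f : x / - x}.
Proof.
move=> fD x; apply: (@addrI _ (f x)).
by rewrite -fD !subrr (morphD_morph0 fD).
Qed.

Section Pointwise.
Context {R : realType} {n : nat} {M : manifold R n}.
Implicit Types (u v : smooth_function M) (X Y : vector_field M).

Lemma sf_ext u v : (forall p, u p = v p) -> u = v.
Proof. by move=> uv; apply: val_inj; apply: funext. Qed.

Lemma sfDE u v p : (u + v) p = u p + v p. Proof. by []. Qed.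
Lemma sfNE u p : (- u) p = - u p. Proof. by []. Qed.
Lemma sf0E p : (0 : smooth_function M) p = 0. Proof. by []. Qed.
Definition sfE := (sfDE, sfNE, sf0E).

Lemma vfDE X Y u : (X + Y) u = X u + Y u. Proof. by []. Qed.
Lemma vfNE X u : (- X) u = - X u. Proof. by []. Qed.
Lemma vf0E u : (0 : vector_field M) u = 0. Proof. by []. Qed.
Definition vfE := (vfDE, vfNE, vf0E).

Lemma vfN X u : X (- u) = - X u.
Proof. exact: (morphD_morphN (vfD X)). Qed.

End Pointwise.

(** Evaluation at a point turns linear relations between smooth functions into
    linear arithmetic over the reals, where [u + u = 0] implies [u = 0];
    [vf_lra] evaluates vector fields at a function first. The equations in the
    context are used as hypotheses. *)
Ltac sf_lra :=
  let p := fresh "p" in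
  apply: sf_ext; intro p;
  repeat match goal with
  | H : _ = _ |- _ =>
      apply (congr1 (fun w : smooth_function _ => smooth_fun w p)) in H;
      cbv beta in H; rewrite ?sfE in H; revert H
  end;
  intros; rewrite ?sfE; lra.

Ltac vf_lra :=
  let f := fresh "f" in
  apply: vf_ext; intro f;
  repeat match goal with
  | H : _ = _ |- _ =>
      apply (congr1 (fun W : vector_field _ => vf_fun W f)) in H;
      cbv beta in H; rewrite ?vfE in H; revert H
  end;
  intros; rewrite ?vfE; sf_lra.

Section Tensors.
Context {R : realType} {n : nat} {M : manifold R n}.
Local Notation C := (smooth_function M).
Local Notation VF := (vector_field M).
Implicit Types (X Y Z : VF) (b g : VF -> VF -> C).

Lemma tensor2Dl b : tensor2 b -> forall Z, {morph b^~ Z : X Y / X + Y}.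
Proof. by move=> [bl _] Z X Y; have := bl 1 X Y Z; rewrite scale1r mul1r. Qed.

Lemma tensor2Nl b : tensor2 b -> forall Z, {morph b^~ Z : X / - X}.
Proof. by move=> hb Z; exact: morphD_morphN (tensor2Dl hb Z). Qed.

Lemma tensor2Dr b : tensor2 b -> forall Z, {morph b Z : X Y / X + Y}.
Proof. by move=> [_ br] Z X Y; have := br 1 X Y Z; rewrite scale1r mul1r. Qed.

Lemma tensor2Nr b : tensor2 b -> forall Z, {morph b Z : X / - X}.
Proof. by move=> hb Z; exact: morphD_morphN (tensor2Dr hb Z). Qed.

(** The metric is positive only where the field does not vanish, so positivity
    is used one point at a time. *)
Lemma metric_definite g : riemannian_metric g -> forall X, g X X = 0 -> X = 0.
Proof.
move=> [_ _ gpos] X gXX; apply: vf_ext => f; apply: sf_ext => p.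
have [->//|nX] := pselect (vanishes_at X p).
by have := gpos X p nX; rewrite gXX sf0E ltxx.
Qed.

Lemma metric_nondegenerate g : riemannian_metric g ->
  forall X, (forall Z, g X Z = 0) -> X = 0.
Proof. by move=> hg X gX; apply: metric_definite hg _ (gX X). Qed.

Lemma metric_ext g : riemannian_metric g ->
  forall X Y, (forall Z, g X Z = g Y Z) -> X = Y.
Proof.
move=> hg X Y gXY; have [tg _ _] := hg; apply/eqP; rewrite -subr_eq0.
apply/eqP/(metric_nondegenerate hg) => Z.
by rewrite (tensor2Dl tg) (tensor2Nl tg) gXY subrr.
Qed.

End Tensors.

(** * Covariant derivatives of an almost complex structure *)

Section Derivatives.
Context {R : realType} {n : nat} {M : manifold R n}.
Local Notation VF := (vector_field M).
Implicit Types (nabla A : VF -> VF -> VF) (Theta : VF -> VF) (X Y Z : VF).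

(** Locked, so that rewriting with additivity does not see through the
    difference. *)
Definition cov_derivative_end nabla Theta X Y : VF :=
  locked (nabla X (Theta Y) - Theta (nabla X Y)).

Lemma cov_derivative_endE nabla Theta X Y :
  cov_derivative_end nabla Theta X Y = nabla X (Theta Y) - Theta (nabla X Y).
Proof. by rewrite /cov_derivative_end -lock. Qed.

(** [(nabla_X A)_Y Z] for a vector-valued bilinear form [A]; with
    [A = nabla Theta] this is the second covariant derivative of [Theta]. *)
Definition cov_derivative_bil nabla A X Y Z : VF :=
  nabla X (A Y Z) - A (nabla X Y) Z - A Y (nabla X Z).

End Derivatives.

Section AlmostComplex.
Context {R : realType} {n : nat} {M : manifold R n}.
Local Notation VF := (vector_field M).
Implicit Types (X Y Z : VF).

Context (nabla : VF -> VF -> VF) (nablaL : linear_connection nabla).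
Context (Theta : VF -> VF) (ThetaC : almost_complex_structure Theta).
Local Notation A := (cov_derivative_end nabla Theta).
Local Notation B := (cov_derivative_bil nabla A).

Lemma connDl Z : {morph nabla^~ Z : X Y / X + Y}.
Proof. by case: nablaL => nl _ _ X Y; have := nl 1 X Y Z; rewrite !scale1r. Qed.

Lemma connDr X : {morph nabla X : Y Z / Y + Z}.
Proof. by case: nablaL => _ nr _ Y Z; exact: nr. Qed.

Lemma connNl Z : {morph nabla^~ Z : X / - X}.
Proof. exact: morphD_morphN (connDl Z). Qed.

Lemma connNr X : {morph nabla X : Y / - Y}.
Proof. exact: morphD_morphN (connDr X). Qed.

Lemma acsD : {morph Theta : X Y / X + Y}.
Proof. by case: ThetaC => tl _ X Y; have := tl 1 X Y; rewrite !scale1r. Qed.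

Lemma acsN : {morph Theta : X / - X}.
Proof. exact: morphD_morphN acsD. Qed.

Lemma acsK X : Theta (Theta X) = - X.
Proof. by case: ThetaC. Qed.

Lemma acs_inj : injective Theta.
Proof. by move=> X Y /(congr1 Theta); rewrite !acsK => /oppr_inj. Qed.

Lemma cov_end_Dl Z : {morph A^~ Z : X Y / X + Y}.
Proof.
move=> X Y; rewrite !cov_derivative_endE !connDl acsD; vf_lra.
Qed.

Lemma cov_end_Nl Z : {morph A^~ Z : X / - X}.
Proof. exact: morphD_morphN (cov_end_Dl Z). Qed.

(** Derivative of [Theta^2 = - 1]. *)
Lemma cov_end_anticomm X Y : A X (Theta Y) = - Theta (A X Y).
Proof.
rewrite !cov_derivative_endE acsK !(acsD, acsN, connNr, acsK); vf_lra.
Qed.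

Context (nablaT : torsion_free nabla).

(** The right-hand side is the commutator of the curvature operator with
    [Theta]; it vanishes identically exactly under the curvature condition of
    the theorem. *)
Lemma ricci_identity X Y Z :
  B X Y Z - B Y X Z =
  curvature nabla X Y (Theta Z) - Theta (curvature nabla X Y Z).
Proof.
rewrite /curvature -nablaT /cov_derivative_bil !cov_derivative_endE.
rewrite !(connDl, connNl, connDr, connNr, acsD, acsN); vf_lra.
Qed.

(** Without torsion every bracket is [nabla_X Y - nabla_Y X], and the terms in
    which [nabla] differentiates [X] or [Y] rather than [Theta] cancel. *)
Lemma nijenhuisE X Y :
  nijenhuis Theta X Y =
  A (Theta X) Y - A (Theta Y) X + Theta (A Y X) - Theta (A X Y).
Proof.
rewrite /nijenhuis -!nablaT !cov_derivative_endE.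
rewrite !(acsD, acsN, acsK); vf_lra.
Qed.

(** By symmetry and anticommutation [A (Theta X) Y = - Theta (A Y X)], so the
    four terms of [nijenhuisE] cancel in pairs. Besides the Levi-Civita
    connection, this is applied to the connection of a statistical structure. *)
Lemma symmetric_integrable :
  (forall X Y, A X Y = A Y X) -> Defs.integrable Theta.
Proof.
move=> sA X Y; rewrite nijenhuisE (sA _ Y) (sA _ X) !cov_end_anticomm.
vf_lra.
Qed.

Lemma parallel_curvature : (forall X Y, A X Y = 0) ->
  forall X Y Z, curvature nabla X Y (Theta Z) = Theta (curvature nabla X Y Z).
Proof.
move=> A0 X Y Z; apply/eqP; rewrite -subr_eq0 -ricci_identity; apply/eqP.
by rewrite /cov_derivative_bil !A0 !(morphD_morph0 (connDr _)) !subr0.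
Qed.

End AlmostComplex.

(** * Almost Kaehler manifolds *)

Section AlmostKahler.
Context {R : realType} {n : nat} {M : manifold R n}.
Local Notation C := (smooth_function M).
Local Notation VF := (vector_field M).
Implicit Types (U V W X Y Z : VF).

Context (omega g : VF -> VF -> C) (Theta : VF -> VF) (nabla : VF -> VF -> VF).
Context (hK : almost_kahler omega Theta g) (hLC : levi_civita g nabla).
Local Notation A := (cov_derivative_end nabla Theta).
Local Notation B := (cov_derivative_bil nabla A).

Let hT : almost_complex_structure Theta. Proof. by case: hK. Qed.
Let hg : riemannian_metric g. Proof. by case: hK. Qed.
Let hn : linear_connection nabla. Proof. by case: hLC. Qed.
Let tf : torsion_free nabla. Proof. by case: hLC. Qed.
Let tg : tensor2 g. Proof. by case: hg. Qed.
Let gC X Y : g X Y = g Y X. Proof. by case: hg. Qed.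
Let gE := (tensor2Dl tg, tensor2Nl tg, tensor2Dr tg, tensor2Nr tg).
Let omegaE X Y : omega X Y = g (Theta X) Y. Proof. by case: hK. Qed.

Lemma metric_acs_skew X Y : g (Theta X) Y = - g X (Theta Y).
Proof.
have [_ _ _ gT _] := hK.
by rewrite -(gT X (Theta Y)) (acsK hT) !gE opprK.
Qed.

Lemma metric_compatible X Y Z : X (g Y Z) = g (nabla X Y) Z + g Y (nabla X Z).
Proof.
case: hLC => _ _ /(_ X Y Z); rewrite /cov_derivative2 => H.
apply/eqP; rewrite -subr_eq0 opprD addrA; exact/eqP.
Qed.

(** Derivative of the skew-adjointness of [Theta]. *)
Lemma cov_end_skew X Y Z : g (A X Y) Z = - g Y (A X Z).
Proof.
have := congr1 X (metric_acs_skew Y Z).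
rewrite vfN !metric_compatible !cov_derivative_endE !gE !metric_acs_skew => H.
have E : g Y (Theta (nabla X Z)) = - g (Theta Y) (nabla X Z).
  by rewrite metric_acs_skew opprK.
sf_lra.
Qed.

Lemma cov_derivative2_omega X Y Z :
  cov_derivative2 nabla omega X Y Z = g (A X Y) Z.
Proof.
rewrite /cov_derivative2 !cov_derivative_endE !omegaE metric_compatible !gE.
ring.
Qed.

(** For a torsion-free connection the exterior derivative of a 2-form is the
    cyclic sum of its covariant derivative, so this is the closedness of
    [omega]. *)
Lemma cov_end_cyclic X Y Z : g (A X Y) Z + g (A Y Z) X + g (A Z X) Y = 0.
Proof.
have [[tw ww dw _] _ _ _ _] := hK.
have wC U V : omega U V = - omega V U.
  by rewrite !omegaE metric_acs_skew gC.
have := dw X Y Z; rewrite /ext_derivative -!tf.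
rewrite !(tensor2Dl tw, tensor2Nl tw) -!cov_derivative2_omega /cov_derivative2.
rewrite (wC X Z) vfN => H.
have E1 := wC Y (nabla X Z); have E2 := wC Z (nabla Y X).
have E3 := wC X (nabla Z Y); have E4 := wC (nabla X Y) Z.
sf_lra.
Qed.

(** Put [P, Q, S] for the cyclic permutations of [g (A X Y) Z], and [P', Q', S']
    for the same with [Theta] applied to the first two arguments. The cyclic
    identity gives [P + Q + S = 0] and, at arguments [X, Theta Y, Theta Z] and
    permutations, [P = Q' + S'], [Q = S' + P'], [S = P' + Q']. Adding up,
    [P' + Q' + S' = 0], whence [P' = - P]. *)
Lemma quasi_kahler X Y : A (Theta X) Y = - Theta (A X Y).
Proof.
have key U V W : g (A (Theta U) (Theta V)) W = - g (A U V) W.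
  have a1 S P Q : g (A S (Theta P)) Q = g (A S P) (Theta Q).
    by rewrite (cov_end_anticomm hn hT) !gE metric_acs_skew opprK.
  have a2 S P Q : g (A S (Theta P)) (Theta Q) = - g (A S P) Q.
    by rewrite a1 (acsK hT) !gE.
  (* Theta moves freely between the last two slots of g (A S P) Q, and two
     occurrences of it there amount to a change of sign. *)
  have c S P Q : g (A (Theta P) (Theta Q)) S + g (A (Theta Q) (Theta S)) P
                 = g (A S P) Q.
    have := cov_end_cyclic S (Theta P) (Theta Q).
    rewrite a2 -(a1 (Theta Q) S P) => H; sf_lra.
  have c1 := c U V W; have c2 := c V W U; have c3 := c W U V.
  have c0 := cov_end_cyclic U V W.
  sf_lra.
apply: acs_inj hT _ _ _; apply: (metric_ext hg) => Z.
have := key X Y Z; rewrite (cov_end_anticomm hn hT) (acsN hT) (acsK hT) !gE.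
by move=> /oppr_inj ->; rewrite opprK.
Qed.

Lemma symmetric_parallel : (forall X Y, A X Y = A Y X) ->
  forall X Y, A X Y = 0.
Proof.
move=> sA X Y; apply: (metric_nondegenerate hg) => Z.
have a2 U V W : g (A U V) W = - g (A U W) V by rewrite cov_end_skew gC.
have a1 U V W : g (A U V) W = g (A V U) W by rewrite sA.
(* Alternating the swaps (23) and (12) three times each returns to the starting
   order with sign -1. *)
have e1 := a2 X Y Z; have e2 := a1 X Z Y; have e3 := a2 Z X Y.
have e4 := a1 Z Y X; have e5 := a2 Y Z X; have e6 := a1 Y X Z.
sf_lra.
Qed.

Lemma integrable_symmetric : Defs.integrable Theta -> forall X Y, A X Y = A Y X.
Proof.
move=> N0 X Y; have := N0 X Y.
rewrite (nijenhuisE hT tf) !quasi_kahler => H.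
apply: acs_inj hT _ _ _; vf_lra.
Qed.

Lemma integrable_parallel : Defs.integrable Theta -> forall X Y, A X Y = 0.
Proof. by move=> hI; apply/symmetric_parallel/integrable_symmetric. Qed.

(** Covariant derivative along [W] of the identity [quasi_kahler]; the last term
    comes from [nabla_W (Theta X) = A W X + Theta (nabla_W X)]. *)
Lemma cov_bil_acs W X Z :
  B W (Theta X) Z = - Theta (B W X Z) - A W (A X Z) - A (A W X) Z.
Proof.
have dT U V : nabla U (Theta V) = A U V + Theta (nabla U V).
  by rewrite !cov_derivative_endE subrK.
rewrite /cov_derivative_bil [A (Theta X) Z]quasi_kahler dT (connNr hn) dT.
rewrite (cov_end_Dl hn hT) !quasi_kahler !(acsD hT, acsN hT).
vf_lra.
Qed.

(** The formula [e] below is not manifestly symmetric in [U] and [V]: exchanging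
    them changes the sign of [A (A V U) - A (A U V)] and keeps the rest. As the
    left-hand side is symmetric, this difference vanishes. *)
Lemma cov_bil_symmetric_cov_end : (forall X Y Z, B X Y Z = B Y X Z) ->
  forall X Y Z, A (A X Y) Z = A (A Y X) Z.
Proof.
move=> sB X Y Z.
have e U V : B (Theta U) (Theta V) Z =
    - B U V Z + Theta (A V (A U Z)) + Theta (A U (A V Z))
    + Theta (A (A V U) Z) - Theta (A (A U V) Z).
  rewrite cov_bil_acs (sB (Theta U)) cov_bil_acs !quasi_kahler (sB V U).
  rewrite (cov_end_Nl hn hT) quasi_kahler !(acsD hT, acsN hT) !(acsK hT).
  vf_lra.
have := sB (Theta X) (Theta Y) Z; rewrite !e (sB Y X) => H.
apply: acs_inj hT _ _ _; vf_lra.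
Qed.

(** Goldberg's theorem. In the cyclic identity at [T, X, Y] the term with [A T]
    vanishes, and by skewness the two others add up to [g T T]. *)
Lemma curvature_symmetric :
  (forall X Y Z,
    curvature nabla X Y (Theta Z) = Theta (curvature nabla X Y Z)) ->
  forall X Y, A X Y = A Y X.
Proof.
move=> hR X Y; apply/eqP; rewrite -subr_eq0; apply/eqP.
set T := A X Y - A Y X; apply: (metric_definite hg).
have sB U V W : B U V W = B V U W.
  by apply/eqP; rewrite -subr_eq0 (ricci_identity hn hT tf) hR subrr.
have AT0 Z : A T Z = 0.
  rewrite (cov_end_Dl hn hT) (cov_end_Nl hn hT).
  by rewrite (cov_bil_symmetric_cov_end sB) subrr.
have c := cov_end_cyclic T X Y; rewrite AT0 in c.
have e := cov_end_skew Y T X; rewrite (gC T) in e.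
have z : g 0 Y = 0 := morphD_morph0 (tensor2Dl tg Y).
have d : g T T = g (A X Y) T - g (A Y X) T by rewrite {1}/T !gE.
sf_lra.
Qed.

(** [Theta (D_X Theta) Y = D_X Y - D'_X Y], and the difference of two
    torsion-free connections is symmetric. *)
Lemma statistical_integrable :
  statistical_almost_kahler omega Theta g -> Defs.integrable Theta.
Proof.
move=> [_ [D [D' [[hD hD'] [tD tD'] dual Dw]]]].
(* Compare D omega = 0 with the duality of D and D', both applied to
   X (g (Theta Y) Z). *)
have D'E X Y : D' X (Theta Y) = Theta (D X Y).
  apply: (metric_ext hg) => Z.
  have := Dw X Y Z; rewrite /cov_derivative2 !omegaE (gC _ Z) dual => H.
  have e1 := gC (D' X (Theta Y)) Z; have e2 := gC (D X Z) (Theta Y).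
  sf_lra.
have ThetaA X Y : Theta (cov_derivative_end D Theta X Y) = D X Y - D' X Y.
  have -> : D' X Y = - Theta (D X (Theta Y)).
    by rewrite -D'E (acsK hT) (connNr hD') opprK.
  rewrite !cov_derivative_endE (acsD hT) (acsN hT) (acsK hT); vf_lra.
apply: (symmetric_integrable hD hT tD) => X Y.
apply: acs_inj hT _ _ _; rewrite !ThetaA.
have t := tD X Y; have t' := tD' X Y; vf_lra.
Qed.

Lemma parallel_statistical : (forall X Y, A X Y = 0) ->
  statistical_almost_kahler omega Theta g.
Proof.
move=> A0; split=> //; exists nabla, nabla; split=> //.
  by move=> X Y Z; exact: metric_compatible.
move=> X Y Z; rewrite cov_derivative2_omega A0.
by rewrite (morphD_morph0 (tensor2Dl tg Z)).
Qed.

End AlmostKahler.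

Theorem proposition6p13 (R : realType) (d : nat) (M : manifold R d.*2)
    (omega : vector_field M -> vector_field M -> smooth_function M)
    (Theta : vector_field M -> vector_field M)
    (g : vector_field M -> vector_field M -> smooth_function M)
    (nabla_lc : vector_field M -> vector_field M -> vector_field M)
    (h_almost_kahler : almost_kahler omega Theta g)
    (h_levi_civita : levi_civita g nabla_lc) :
  (statistical_almost_kahler omega Theta g <->
   (forall X Y Z : vector_field M,
      curvature nabla_lc X Y (Theta Z) = Theta (curvature nabla_lc X Y Z))) /\
  ((forall X Y Z : vector_field M,
      curvature nabla_lc X Y (Theta Z) = Theta (curvature nabla_lc X Y Z)) <->
   kahler omega Theta g).
Proof.
have [_ hT _ _ _] := h_almost_kahler; have [hn tf _] := h_levi_civita.
have parallel_of_curvature hR :=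
  symmetric_parallel h_almost_kahler h_levi_civita
    (curvature_symmetric h_almost_kahler h_levi_civita hR).
have curvature_of_integrable hI := parallel_curvature hn hT tf
  (integrable_parallel h_almost_kahler h_levi_civita hI).
split; split.
- by move=> /(statistical_integrable h_almost_kahler) /curvature_of_integrable.
- by move=> /parallel_of_curvature; exact: parallel_statistical.
- move=> /parallel_of_curvature A0; split=> //.
  by apply: (symmetric_integrable hn hT tf) => X Y; rewrite !A0.
- by move=> [_ /curvature_of_integrable].
Qed.
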